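(* Let $f$ be a Z-reduced form. The binary string $\sigma(R_Z(f))$ is obtained from $\sigma(f)$ by cycling as follows: (i) If $\sigma(f)$ begins with a $0$, then the initial $0$ is removed from the front and appended to the back. (ii) If $\sigma(f)$ has just one initial $1$ and all succeeding characters are $0$, then the initial $1$ is removed from the front and appended to the back. (iii) If $\sigma(f)$ begins with a $1$ and contains at least two $1$s, then the string is cyclically rotated so that its second $1$ is moved to the final position.
   Context: A form $(A,B,C)$ means the binary quadratic form $Ax^2+Bxy+Cy^2$ with $A,B,C\in\mathbb{Z}$; its discriminant is $\Delta=B^2-4AC$. All forms are indefinite: $\Delta$ is positive and not a square. The form is Z-reduced if $A,B,C>0$ and $B>A+C$; $Z$ is the set of Z-reduced forms. Zagier reduction operator: for $f=(A,B,C)$ of discriminant $\Delta$, put $n=\left\lceil \frac{B+\sqrt{\Delta}}{2A}\right\rceil$ and $R_Z(f)=f(nx+y,-x)$. It maps $Z$ to $Z$. Fundamental solution: for a positive nonsquare discriminant $\Delta$, the fundamental solution of $|t^2-\Delta u^2|=4$ is the solution $(t,u)$ in positive integers with $u$ minimal (for $\Delta=5$, where $(1,1)$ and $(3,1)$ both have $u=1$, it is $(1,1)$). Bead sequence: for $f=(A,B,C)\in Z$ of discriminant $\Delta$ with fundamental solution $(t,u)$, set $z=\frac{t+Bu}{2}$ (an integer) and expand $\frac{z}{z-Au}$ as a finite regular continued fraction with positive integer partial quotients $q_1,\dots,q_l$, choosing between the two possible expansions (whose lengths have opposite parity) so that $l$ is even if $t^2-\Delta u^2=-4$ and odd otherwise.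 Then $\beta(f)=(q_1,\dots,q_l)$. It is always the case that $l\ge 2$. Stars-and-bars map: for a sequence $(q_1,\dots,q_l)$ of positive integers with $l\ge2$, place $q_1+\cdots+q_l$ stars in a row and $l-1$ bars in gaps between stars so that the stars are divided, from left to right, into bunches of sizes $q_1,\dots,q_l$. Reading the gaps between consecutive stars from left to right, write $0$ for an empty gap and $1$ for a gap with a bar; the resulting binary string is $\mathrm{sb}((q_1,\dots,q_l))$. That is, $\mathrm{sb}((q_1,\dots,q_l))=0^{q_1-1}1\,0^{q_2-1}1\cdots 1\,0^{q_l-1}$. Finally $\sigma(f)=\mathrm{sb}(\beta(f))$. *)

(* Defs.v *)
From mathcomp Require Import all_boot all_order all_algebra.
From mathcomp Require Import boolp classical_sets reals.
From mathcomp Require Import ring.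

Set Implicit Arguments.
Unset Strict Implicit.
Unset Printing Implicit Defensive.

Import Order.TTheory GRing.Theory Num.Theory.
Local Open Scope classical_set_scope.
Local Open Scope ring_scope.

Record bqf : Type := BQF { coefA : int; coefB : int; coefC : int }.

Definition bqf_eval (f : bqf) (x y : int) : int :=
  coefA f * x ^+ 2 + coefB f * x * y + coefC f * y ^+ 2.

Definition disc (f : bqf) : int := coefB f ^+ 2 - 4 * coefA f * coefC f.

Definition indefinite (f : bqf) : Prop :=
  0 < disc f /\ (forall m : int, m ^+ 2 <> disc f).

Definition Zreduced (f : bqf) : Prop :=
  [/\ indefinite f, 0 < coefA f, 0 < coefB f, 0 < coefC f
    & coefA f + coefC f < coefB f].

(* The form f(a x + b y, c x + d y). *)
Definition bqf_subst (f : bqf) (a b c d : int) : bqf :=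
  let: BQF A B C := f in
  BQF (A * a ^+ 2 + B * a * c + C * c ^+ 2)
      (2 * A * a * b + B * (a * d + b * c) + 2 * C * c * d)
      (A * b ^+ 2 + B * b * d + C * d ^+ 2).

Lemma bqf_eval_subst (f : bqf) (a b c d x y : int) :
  bqf_eval (bqf_subst f a b c d) x y
  = bqf_eval f (a * x + b * y) (c * x + d * y).
Proof. by case: f => A B C; rewrite /bqf_eval /=; ring. Qed.

Definition RZ (R : realType) (f : bqf) : bqf :=
  let n : int :=
    Num.ceil (((coefB f)%:~R + Num.sqrt ((disc f)%:~R : R))
              / (2 * (coefA f)%:~R)) in
  bqf_subst f n 1 (-1) 0.

Definition pell4 (D t u : int) : Prop :=
  [/\ 0 < t, 0 < u & `|t ^+ 2 - D * u ^+ 2| = 4].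

Definition is_fundamental (D : int) (p : int * int) : Prop :=
  [/\ pell4 D p.1 p.2,
      forall t u : int, pell4 D t u -> p.2 <= u
    & D = 5 -> p = (1, 1)].

(* Such a pair exists and is unique when D is a positive nonsquare
   discriminant; otherwise the value may be the dummy (0, 0). *)
Definition fundamental (D : int) : int * int :=
  xget (0, 0) [set p | is_fundamental D p].

(* The conventions 0^-1 = 0 and cf_value [::] = 0 make this
   cf_value [:: q] = q on singletons. *)
Fixpoint cf_value (q : seq nat) : rat :=
  if q is a :: q' then a%:R + (cf_value q')^-1 else 0.

(* z is computed in rat, so that no division is truncated. *)
Definition is_beads (f : bqf) (q : seq nat) : Prop :=
  let: (t, u) := fundamental (disc f) in
  let z : rat := (t + coefB f * u)%:~R / 2 in
  [/\ all (fun a : nat => (0 < a)%N) q,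
      cf_value q = z / (z - (coefA f * u)%:~R)
    & odd (size q) = (t ^+ 2 - disc f * u ^+ 2 != -4)].

(* Exactly one sequence satisfies is_beads f when f is Z-reduced: the two
   expansions of a rational number greater than 1 differ in parity of length. *)
Definition beta (f : bqf) : seq nat := xget [::] [set q | is_beads f q].

(* The characters 0 and 1 are false and true. *)
Definition sb (q : seq nat) : seq bool :=
  if q is a :: q' then
    nseq a.-1 false ++ flatten [seq true :: nseq b.-1 false | b <- q']
  else [::].

Definition sigma (f : bqf) : seq bool := sb (beta f).

(* Main.v *)
Require Import Defs.
From mathcomp Require Import all_boot all_order all_algebra.
From mathcomp Require Import boolp classical_sets reals.
From mathcomp Require Import ring zify.

(** Write [B(q)] for the matrix with rows [(q, 1)], [(1, 0)]. The product
    [B(q_1) ... B(q_l)] has determinant [(-1)^l], and its first column is the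
    reduced fraction with partial quotients [q_1, ..., q_l]. Let [f = (A, B, C)]
    be Z-reduced, [t^2 - D u^2 = 4 e] with [e = 1] or [-1], and
    [z = (t + B u) / 2]. The matrix
<<
      N(f) = (  z        z - C u         )
             (  z - A u  (B - A - C) u   )
>>
    has determinant [- e], and reducedness of [f] makes its entries positive
    with a dominant first row. A matrix product with the first column and the
    determinant of [N(f)] then has no freedom left in the second column, so the
    rule fixing the parity of [l] says exactly that [B(q_1) ... B(q_l) = N(f)]
    (lemma [is_beadsE]). Such a factorization is unique ([cfmx_inj]).

    Now let [g] be the form [f (n x + y, - x)] with [n = b + 2]. A direct
    computation ([beadmx_zstep]) gives
<<
      N(g) = (  1   -1   ) N(f) ( b + 1  b )
             ( - b  b + 1)      ( 1      1 )
>>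
    If the beads of [f] are [(1, b, r)], the left factor is the inverse of
    [B(1) B(b)] and the right factor is [B(b) B(1)], so [N(g)] is the product of
    the matrices of [(r, b, 1)]. If the first bead is at least [2], take
    [b = 0]: the left factor lowers the first bead by one and the right factor
    raises the last one by one. In both cases [N(g)] is a product of at least
    two matrices [B(q)] with [q > 0], so [A_g u], the difference of the entries
    of its first column, and [(B_g - A_g - C_g) u], its last entry, are
    positive. As [C_g = A > 0], the form [g] is Z-reduced. The same two inequalities say that
    [A x^2 - B x + C] is positive at [n] and negative at [n - 1], so
    [n] is the ceiling in the definition of the reduction operator and
    [g = R_Z(f)] ([RZ_zstep]). It follows that [(r, b, 1)], respectively the
    shifted sequence, is the bead sequence of [R_Z(f)], and translating to stars
    and bars gives the three rotations: (ii) and (iii) are the cases [r] empty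
    and [r] nonempty of the same rule. *)

Set Implicit Arguments.
Unset Strict Implicit.
Unset Printing Implicit Defensive.

Import Defs Order.TTheory GRing.Theory Num.Theory.
Local Open Scope ring_scope.

(** * Two-by-two integer matrices *)

Definition mx2 (a b c d : int) : 'M[int]_2 :=
  \matrix_(i, j) (if i == 0 then if j == 0 then a else b
                  else if j == 0 then c else d).

Lemma mx2E a b c d :
  (mx2 a b c d 0 0 = a) * (mx2 a b c d 0 1 = b)
  * (mx2 a b c d 1 0 = c) * (mx2 a b c d 1 1 = d).
Proof. by rewrite !mxE. Qed.

Lemma mx2_eta (M : 'M[int]_2) : M = mx2 (M 0 0) (M 0 1) (M 1 0) (M 1 1).
Proof.
apply/matrixP => i j; rewrite mxE.
by case: i => [[|[|i]] ?] //; case: j => [[|[|j]] ?] //=;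
  congr (M _ _); apply/val_inj.
Qed.

Lemma mx2_inj a b c d a' b' c' d' :
  mx2 a b c d = mx2 a' b' c' d' -> [/\ a = a', b = b', c = c' & d = d'].
Proof.
move=> /matrixP e.
by have := (e 0 0, e 0 1, e 1 0, e 1 1); rewrite !mx2E => -[[[-> ->] ->] ->].
Qed.

Lemma mulmx2 a b c d a' b' c' d' :
  mx2 a b c d *m mx2 a' b' c' d'
  = mx2 (a * a' + b * c') (a * b' + b * d') (c * a' + d * c') (c * b' + d * d').
Proof.
by rewrite [LHS]mx2_eta !mxE !big_ord_recl !big_ord0 !mxE /= !addr0.
Qed.

Lemma det_mx2 a b c d : \det (mx2 a b c d) = a * d - b * c.
Proof.
rewrite (expand_det_row _ 0) !big_ord_recl big_ord0 /cofactor !det_mx11 !mxE /=.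
ring.
Qed.

(** * Continued fractions as matrix products *)

Definition cfmx : seq nat -> 'M[int]_2 :=
  foldr (fun (a : nat) M => mx2 a 1 1 0 *m M) 1%:M.

Arguments cfmx : simpl never.

Lemma cfmx_cons (x : nat) s :
  cfmx (x :: s) = mx2 (x%:Z * cfmx s 0 0 + cfmx s 1 0)
                      (x%:Z * cfmx s 0 1 + cfmx s 1 1) (cfmx s 0 0) (cfmx s 0 1).
Proof.
rewrite [LHS]/cfmx [LHS]/= -/(cfmx s) {1}(mx2_eta (cfmx s)) mulmx2.
by rewrite !mul1r !mul0r !addr0.
Qed.

Lemma cfmx_cat s1 s2 : cfmx (s1 ++ s2) = cfmx s1 *m cfmx s2.
Proof.
by rewrite /cfmx; elim: s1 => [|x s1 IH] /=; rewrite ?mul1mx // IH mulmxA.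
Qed.

Lemma det_cfmx q : \det (cfmx q) = (-1) ^+ size q.
Proof.
elim: q => [|x q IH]; first by rewrite det1.
rewrite /cfmx /= -/(cfmx q).
by rewrite det_mulmx IH det_mx2 exprS mulr0 mulr1 sub0r.
Qed.

Lemma cfmx_nil : cfmx [::] = mx2 1 0 0 1.
Proof. by rewrite [LHS]mx2_eta !mxE. Qed.

Definition pos_seq (q : seq nat) := all (fun a : nat => (0 < a)%N) q.

Lemma cfmx_rev q : cfmx (rev q) = (cfmx q)^T.
Proof.
elim: q => [|x q IH]; first by rewrite trmx1.
rewrite rev_cons -cats1 cfmx_cat IH trmx_mul /cfmx /= mulmx1; congr (_ *m _).
by rewrite [RHS]mx2_eta !mxE.
Qed.

Lemma cfmx_col q : pos_seq q ->
  [/\ 0 < cfmx q 0 0, 0 <= cfmx q 1 0 <= cfmx q 0 0,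
      0 <= cfmx q 0 1, 0 <= cfmx q 1 1 & cfmx q 1 0 = 0 -> q = [::]].
Proof.
elim: q => [|x q IH]; first by rewrite cfmx_nil !mx2E.
move=> /andP[x0 /IH[a0 /andP[c0 ca] b0 d0 _]].
by rewrite cfmx_cons !mx2E; split; nia.
Qed.

(** The reversed product is the transpose, so the bounds on the first column
    carry over to the first row. *)
Lemma cfmx_row q : pos_seq q ->
  0 <= cfmx q 0 1 <= cfmx q 0 0 /\ (cfmx q 0 1 = 0 -> q = [::]).
Proof.
rewrite /pos_seq -all_rev => /cfmx_col; rewrite cfmx_rev !mxE.
move=> [_ -> _ _ h]; split=> // /h e.
by rewrite -(revK q) e.
Qed.

Lemma cfmx_size_ge2 q : pos_seq q -> (2 <= size q)%N ->
  cfmx q 1 0 < cfmx q 0 0 /\ 0 < cfmx q 1 1.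
Proof.
case: q => [|x [|y s]] // pq _.
have [x0 py] : (0 < x)%N /\ pos_seq (y :: s) by apply/andP.
have [a0 /andP[c0 _] _ _ hc] := cfmx_col py.
have [/andP[b0 _] hb] := cfmx_row py.
have {hc} c1 : cfmx (y :: s) 1 0 != 0 by apply/eqP => /hc.
have {hb} b1 : cfmx (y :: s) 0 1 != 0 by apply/eqP => /hb.
by rewrite cfmx_cons !mx2E; split; nia.
Qed.

(** Two factorizations with first factors [B(x)] and [B(y)] have tails with the
    same first row, and [x - y] times the corner entry of the tails is a
    difference of two numbers between [0] and that entry. So [x <> y] forces a
    zero in the lower left corner of one tail, which is therefore empty; then
    the shared first row is [(1, 0)], the other tail is empty too, and [x = y]. *)
Lemma cfmx_inj q q' : pos_seq q -> pos_seq q' -> cfmx q = cfmx q' -> q = q'.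
Proof.
have nil_cons x s : pos_seq (x :: s) -> cfmx [::] <> cfmx (x :: s).
  move=> /andP[_ /cfmx_col[a0 _ _ _ _]]; rewrite cfmx_nil cfmx_cons.
  by case/mx2_inj => _ _ e; rewrite -e in a0.
elim: q q' => [|x s IH] [|y s'] //.
- by move=> _ /nil_cons h /h.
- by move=> /nil_cons h _ /esym /h.
move=> /andP[_ ps] /andP[_ ps']; rewrite !cfmx_cons.
case/mx2_inj => e1 e2 ea eb.
have [a0 /andP[c0 ca] _ _ hc] := cfmx_col ps.
have [_ /andP[c0' ca'] _ _ hc'] := cfmx_col ps'.
have [_ hb] := cfmx_row ps.
have [_ hb'] := cfmx_row ps'.
have exy : x = y.
  have [// | /orP ne] : x = y \/ (x < y)%N || (y < x)%N by lia.
  case: ne => ne.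
  - have s'0 : s' = [::] by apply: hc'; nia.
    have s0 : s = [::] by apply: hb; rewrite eb s'0 cfmx_nil mx2E.
    by move: e1; rewrite s0 s'0 cfmx_nil !mx2E; lia.
  - have s0 : s = [::] by apply: hc; nia.
    have s'0 : s' = [::] by apply: hb'; rewrite -eb s0 cfmx_nil mx2E.
    by move: e1; rewrite s0 s'0 cfmx_nil !mx2E; lia.
rewrite exy in e1 e2 *; congr (_ :: _); apply: IH => //.
rewrite [LHS]mx2_eta [RHS]mx2_eta ea eb.
by rewrite ea in e1; rewrite eb in e2; rewrite (addrI _ e1) (addrI _ e2).
Qed.

(** For the empty sequence both sides are [0], since [0^-1 = 0]. *)
Lemma cf_valueE q : pos_seq q ->
  cf_value q = (cfmx q 0 0)%:~R / (cfmx q 1 0)%:~R.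
Proof.
elim: q => [|x s IH]; first by rewrite cfmx_nil !mx2E invr0 mulr0.
move=> /andP[_ ps] /=; rewrite IH // cfmx_cons !mx2E invf_div.
have [a0 _ _ _ _] := cfmx_col ps.
have a1 : (cfmx s 0 0)%:~R != 0 :> rat by rewrite intr_eq0 gt_eqF.
by rewrite intrD intrM mulrDl mulfK.
Qed.

(** Unimodular matrices have coprime columns, so proportional first columns are
    equal. The second column is then determined up to multiples of the first,
    and the bounds on the upper right entry exclude a nonzero multiple. *)
Lemma mx2_eq_of_column a b c d z b0 w d0 e : 0 < a -> 0 < z -> `|e| = 1 ->
    a * d - b * c = e -> z * d0 - b0 * w = e -> a * w = z * c ->
    0 <= b <= a -> 0 < b0 < z ->
  mx2 a b c d = mx2 z b0 w d0.
Proof.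
move=> a0 z0 e1 ha hz hc hb hb0.
have cac : coprimez a c.
  by apply/coprimezP; exists (e * d, - (e * b)) => /=; nia.
have czw : coprimez z w.
  by apply/coprimezP; exists (e * d0, - (e * b0)) => /=; nia.
have eaz : a = z.
  have az : (a %| z)%Z by rewrite -(Gauss_dvdzl _ cac) -hc dvdz_mulr.
  have za : (z %| a)%Z by rewrite -(Gauss_dvdzl _ czw) hc dvdz_mulr.
  case/dvdzP: az => k hk; case/dvdzP: za => l hl.
  have k0 : 0 < k by nia.
  have l0 : 0 < l by nia.
  nia.
have ewc : w = c by rewrite eaz in hc; apply: (mulfI _ hc); rewrite gt_eqF.
rewrite eaz in ha hb *; rewrite ewc in hz czw *.
have zdb : (z %| b - b0)%Z.
  rewrite -(Gauss_dvdzl _ czw); apply/dvdzP; exists (d - d0).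
  by rewrite mulrBl mulrBl; lia.
have eb : b = b0.
  case/dvdzP: zdb => k hk.
  have k1 : k < 1 by nia.
  have k2 : - 1 < k by nia.
  have k0 : k = 0 by lia.
  by rewrite k0 mul0r in hk; apply: subr0_eq.
have ed : d = d0.
  have e2 : z * d = z * d0 by rewrite eb in ha; lia.
  by apply: (mulfI _ e2); rewrite gt_eqF.
by rewrite eb ed.
Qed.

(** * The matrix of a Z-reduced form *)

(** Its first column is the fraction that defines the beads of [f]. *)
Definition beadmx (f : bqf) (z u : int) : 'M[int]_2 :=
  mx2 z (z - coefC f * u)
      (z - coefA f * u) ((coefB f - coefA f - coefC f) * u).

Lemma det_beadmx f t u z : 2 * z = t + coefB f * u ->
  4 * \det (beadmx f z u) = - (t ^+ 2 - disc f * u ^+ 2).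
Proof.
move=> hz; rewrite det_mx2 /disc.
have -> : t = 2 * z - coefB f * u by rewrite hz addrK.
ring.
Qed.

(** [(t + B u) (t - B u)] is a multiple of [4], and the two factors have the
    same parity. *)
Lemma half_exists f t u : pell4 (disc f) t u -> exists z, 2 * z = t + coefB f * u.
Proof.
case=> _ _ h.
have [z [hz|hz]] : exists z, 2 * z = t + coefB f * u \/ 2 * z + 1 = t + coefB f * u.
  exists ((t + coefB f * u) %/ 2)%Z; lia.
  by exists z.
have ht : t = 2 * z + 1 - coefB f * u by rewrite hz addrK.
move: h; rewrite ht /disc.
set m := (X in `|X|).
have -> : m = 4 * (z ^+ 2 + z - z * coefB f * u + coefA f * coefC f * u ^+ 2)
   + 1 - 2 * (coefB f * u) by rewrite /m; ring.
lia.
Qed.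

(** The determinant is [1] or [-1] and the diagonal product is at least [z >= 2],
    so the two off-diagonal entries have a positive product; their sum is
    [t + (B - A - C) u > 0], so both are positive. *)
Lemma beadmx_pos f t u z : Zreduced f -> pell4 (disc f) t u ->
  2 * z = t + coefB f * u ->
  [/\ 0 < z, 0 < z - coefA f * u & 0 < z - coefC f * u < z].
Proof.
case=> _ A0 B0 C0 hABC [t0 u0 h] hz.
have := det_beadmx hz; rewrite det_mx2.
set T := t ^+ 2 - _ in h *; set k := coefB f - _ - _ => hd.
have k0 : 0 < k by rewrite /k; lia.
have Au : 0 < coefA f * u by rewrite mulr_gt0.
have Cu : 0 < coefC f * u by rewrite mulr_gt0.
have ku : 0 < k * u by rewrite mulr_gt0.
have eBu : coefB f * u = coefA f * u + coefC f * u + k * u by rewrite /k; ring.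
have z2 : 2 <= z by lia.
have zku : z <= z * (k * u) by rewrite ler_peMr //; lia.
have prod : 0 < (z - coefC f * u) * (z - coefA f * u) by clear -hd h zku z2; lia.
have zC : 0 < z - coefC f * u.
  rewrite ltNge; apply/negP => zC.
  have zA : 0 < z - coefA f * u by lia.
  by have := mulr_le0_ge0 zC (ltW zA); lia.
split; [lia | by rewrite pmulr_rgt0 in prod | lia].
Qed.

Lemma det_beadmx_sign f t u z : pell4 (disc f) t u ->
  2 * z = t + coefB f * u ->
  \det (beadmx f z u) = (-1) ^+ (t ^+ 2 - disc f * u ^+ 2 != -4).
Proof.
move=> [_ _ h] /det_beadmx; move: h.
case: eqP => [-> _|ne h] hd; rewrite ?expr0 ?expr1; lia.
Qed.

(** The fraction [z / (z - A u)] fixes the first column of [cfmx q] up to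
    proportionality, and the parity prescribed for the number of beads makes its
    determinant that of [beadmx f z u]; the two matrices then agree. *)
Lemma is_beadsE f t u z q : Zreduced f ->
  fundamental (disc f) = (t, u) -> pell4 (disc f) t u ->
  2 * z = t + coefB f * u ->
  is_beads f q <-> pos_seq q /\ cfmx q = beadmx f z u.
Proof.
move=> Zf hfund hp hz.
have [z0 w0 b0] := beadmx_pos Zf hp hz.
have hdet := det_beadmx_sign hp hz.
rewrite /is_beads hfund.
have -> : (t + coefB f * u)%:~R / 2 = z%:~R :> rat.
  by rewrite -hz intrM mulrC mulKf.
rewrite -intrB; split=> [[pq hcf hodd] | [pq hm]]; last first.
  split=> //; first by rewrite cf_valueE // hm !mx2E.
  have := det_cfmx q; rewrite hm hdet -[in RHS]signr_odd.
  by move=> h; apply/esym/(@signr_inj int).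
split=> //; rewrite cf_valueE // in hcf.
have [a0 /andP[c0 ca] _ _ hnil] := cfmx_col pq.
have [hb _] := cfmx_row pq.
rewrite [LHS]mx2_eta; apply: (@mx2_eq_of_column _ _ _ _ _ _ _ _ (\det (cfmx q))) => //.
- by rewrite det_cfmx normrX normrN1 expr1n.
- by rewrite [in RHS](mx2_eta (cfmx q)) det_mx2.
- by rewrite det_cfmx -signr_odd hodd -hdet det_mx2.
have c1 : cfmx q 1 0 != 0.
  apply/eqP => c1; move/eqP: hcf; rewrite c1 invr0 mulr0 eq_sym mulf_eq0 invr_eq0 !intr_eq0.
  by rewrite !gt_eqF.
move/eqP: hcf; rewrite eqr_div ?intr_eq0 ?(gt_eqF w0) //.
by rewrite -!intrM eqr_int => /eqP.
Qed.

Lemma beta_unique f t u z q : Zreduced f ->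
  fundamental (disc f) = (t, u) -> pell4 (disc f) t u ->
  2 * z = t + coefB f * u -> pos_seq q -> cfmx q = beadmx f z u -> beta f = q.
Proof.
move=> Zf hfund hp hz pq hq; apply: xget_unique.
  exact/(is_beadsE _ Zf hfund hp hz).
move=> q1 /(is_beadsE _ Zf hfund hp hz)[pq1 hq1].
by apply: cfmx_inj => //; rewrite hq1 hq.
Qed.

(** If the discriminant had no fundamental solution, the dummy [(0, 0)] would ask
    for an expansion of [0] with an odd number of partial quotients, and there
    is none. So a form with a nonempty [sigma] comes with a genuine solution. *)
Lemma sigma_beads f : Zreduced f -> sigma f <> [::] ->
  exists t u z, [/\ fundamental (disc f) = (t, u), pell4 (disc f) t u,
    2 * z = t + coefB f * u, pos_seq (beta f) & cfmx (beta f) = beadmx f z u].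
Proof.
move=> Zf sf; have hq : is_beads f (beta f).
  by move: sf; rewrite /sigma /beta; case: xgetP.
case E : (fundamental (disc f)) => [t u].
have hp : pell4 (disc f) t u.
  move: E (E); rewrite {1}/fundamental; case: xgetP => [p _ [h _ _] ep|_ [<- <-] E].
    by rewrite ep in h.
  move: hq; rewrite /is_beads E => -[pq].
  rewrite !mulr0 !addr0 !mul0r cf_valueE // => /eqP.
  have [a0 _ _ _ hnil] := cfmx_col pq.
  rewrite mulf_eq0 invr_eq0 !intr_eq0 gt_eqF //= => /eqP /hnil ->.
  by [].
have [z hz] := half_exists hp.
by exists t, u, z; have [] := (is_beadsE (beta f) Zf E hp hz).1 hq; split.
Qed.

(** * The reduction step on matrices and beads *)

Definition zstep (f : bqf) (n : int) : bqf := bqf_subst f n 1 (-1) 0.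

Lemma disc_zstep f n : disc (zstep f n) = disc f.
Proof. by case: f => A B C; rewrite /disc /=; ring. Qed.

(** With [p x = A x^2 - B x + C], the number [(B + sqrt D) / (2 A)] is the larger
    root of [p]. The leading coefficient of the reduced form gives [p n > 0] and
    the inequality [A + C < B] for it gives [p (n - 1) < 0], so the larger root
    lies between [n - 1] and [n]. In the proof this is read off from
    [(2 A x - B)^2 = D + 4 A (p x)]. *)
Lemma RZ_zstep (R : realType) f n :
  0 < coefA f -> Zreduced (zstep f n) -> RZ R f = zstep f n.
Proof.
case: f => A B C A0 [[]]; rewrite disc_zstep /= in A0 *; move=> D0 _ hA hB hC hABC.
rewrite /RZ; set D := disc _; set c := Num.ceil _; suff -> : c = n by [].
have A0' : 0 < 2 * A%:~R :> R by rewrite mulr_gt0 // ltr0z.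
apply: ceil_def; rewrite ltr_pdivlMr // ler_pdivrMr //= -ltrBlDl -lerBrDl.
have -> : (n - 1)%:~R * (2 * A%:~R) - B%:~R = ((n - 1) * (2 * A) - B)%:~R :> R.
  by rewrite [RHS]intrB !intrM.
have -> : n%:~R * (2 * A%:~R) - B%:~R = (n * (2 * A) - B)%:~R :> R.
  by rewrite [RHS]intrB !intrM.
apply/andP; split.
- apply: (le_lt_trans (ler_norm _)); rewrite -sqrtr_sqr ltr_sqrt.
    have -> : ((n - 1) * (2 * A) - B)%:~R ^+ 2
        = (D + 4 * A * (A * (n - 1) ^+ 2 - B * (n - 1) + C))%:~R :> R.
      by rewrite -rmorphXn; congr _%:~R; rewrite /D /disc /=; ring.
    rewrite ltr_int gtrDl pmulr_rlt0; lia.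
  by rewrite ltr0z.
- have m0 : 0 <= n * (2 * A) - B by lia.
  rewrite -[leRHS]ger0_norm ?ler0z // -sqrtr_sqr ler_sqrt ?sqr_ge0 //.
  have -> : (n * (2 * A) - B)%:~R ^+ 2
      = (D + 4 * A * (A * n ^+ 2 - B * n + C))%:~R :> R.
    by rewrite -rmorphXn; congr _%:~R; rewrite /D /disc /=; ring.
  rewrite ler_int lerDl pmulr_rge0; lia.
Qed.

(** The argument in place of [z] on the left is [(t + B_g u) / 2] for the
    transformed form [g]. *)
Lemma beadmx_zstep f z u b :
  beadmx (zstep f (b + 2)) (z + (coefA f * (b + 2) - coefB f) * u) u
  = mx2 1 (-1) (- b) (b + 1) *m beadmx f z u *m mx2 (b + 1) b 1 1.
Proof.
by case: f => A B C; rewrite /beadmx !mulmx2 /=; congr mx2; ring.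
Qed.

(** A factorization of the transformed matrix into at
    least two positive beads certifies at once that the transformed form is
    Z-reduced, that it is the value of the reduction operator, and that these
    are its beads. *)
Lemma beta_RZ (R : realType) f t u z (b : int) q : Zreduced f ->
  fundamental (disc f) = (t, u) -> pell4 (disc f) t u ->
  2 * z = t + coefB f * u -> pos_seq q -> (2 <= size q)%N ->
  cfmx q = mx2 1 (-1) (- b) (b + 1) *m beadmx f z u *m mx2 (b + 1) b 1 1 ->
  beta (RZ R f) = q.
Proof.
move=> Zf hfund hp hz pq sq; rewrite -beadmx_zstep.
set g := zstep f _; set z' := z + _ => hq.
have Dg : disc g = disc f by exact: disc_zstep.
have [If A0 _ _ _] := Zf; have [_ u0 _] := hp.
have hz' : 2 * z' = t + coefB g * u.
  move: hz; rewrite /z' /g; case: (f) => A B C /= hz.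
  by rewrite mulrDr hz; ring.
have Cg : coefC g = coefA f by rewrite /g; case: (f) => A B C /=; ring.
have [] := cfmx_size_ge2 pq sq; rewrite hq !mx2E => hA hABC.
have {}hA : 0 < coefA g by rewrite -(pmulr_lgt0 _ u0); lia.
have {}hABC : coefA g + coefC g < coefB g.
  by move: hABC; rewrite pmulr_lgt0 //; lia.
have Zg : Zreduced g by split; rewrite ?Cg //; [rewrite /indefinite Dg | lia | lia].
rewrite (RZ_zstep R A0 Zg).
by apply: (beta_unique Zg _ _ hz' pq hq); rewrite Dg.
Qed.

Lemma beta_RZ_cons_ge2 (R : realType) f a b r : Zreduced f -> sigma f <> [::] ->
  beta f = a.+2 :: rcons r b -> beta (RZ R f) = a.+1 :: rcons r b.+1.
Proof.
move=> Zf sf ebeta; have [t [u [z [hfund hp hz pq hq]]]] := sigma_beads Zf sf.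
apply: (beta_RZ R (b := 0) Zf hfund hp hz); last 1 first.
2: by move: pq; rewrite ebeta /pos_seq /= !all_rcons /= => /andP[].
2: by rewrite /= size_rcons.
rewrite -hq ebeta -cat1s -[in RHS]cat1s -!cats1 !cfmx_cat !cfmx_cons !cfmx_nil !mx2E.
rewrite !mulmxA mulmx2 -!mulmxA mulmx2; congr (mx2 _ _ _ _ *m (_ *m mx2 _ _ _ _)); lia.
Qed.

Lemma beta_RZ_cons1 (R : realType) f b r : Zreduced f -> sigma f <> [::] ->
  beta f = [:: 1, b & r] -> beta (RZ R f) = r ++ [:: b; 1].
Proof.
move=> Zf sf ebeta; have [t [u [z [hfund hp hz pq hq]]]] := sigma_beads Zf sf.
apply: (beta_RZ R (b := b%:Z) Zf hfund hp hz); last 1 first.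
2: by move: pq; rewrite ebeta /pos_seq /= all_cat /= andbT andbC.
2: by rewrite size_cat addn2.
rewrite -hq ebeta -[[:: 1, b & r]]/([:: 1; b] ++ r) !cfmx_cat.
rewrite !cfmx_cons cfmx_nil !mx2E !mulmxA !mulmx2.
rewrite -[LHS]mul1mx -[1%:M]/(cfmx [::]) cfmx_nil -[in RHS]mulmxA.
congr (mx2 _ _ _ _ *m (_ *m mx2 _ _ _ _)); ring.
Qed.

(** A single bead would make the lower right entry of the matrix vanish. *)
Lemma size_beta_ge2 f : Zreduced f -> sigma f <> [::] -> (2 <= size (beta f))%N.
Proof.
move=> Zf sf; have [t [u [z [_ hp hz pq hq]]]] := sigma_beads Zf sf.
have [z0 w0 b0] := beadmx_pos Zf hp hz.
have [_ _ _ _ hABC] := Zf; have [_ u0 _] := hp.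
have : 0 < cfmx (beta f) 1 1 by rewrite hq mx2E mulr_gt0 //; lia.
have : 0 < cfmx (beta f) 1 0 by rewrite hq mx2E.
by case: (beta f) => [|x [|y q]] //; rewrite ?cfmx_cons ?cfmx_nil !mx2E.
Qed.

(** * Stars and bars *)

Lemma sb_cat q1 q2 : q1 <> [::] -> q2 <> [::] ->
  sb (q1 ++ q2) = sb q1 ++ true :: sb q2.
Proof.
case: q1 => // a q1 _; case: q2 => // b q2 _.
by rewrite /= map_cat flatten_cat catA.
Qed.

Lemma sb_incr_last q b : q <> [::] -> (0 < b)%N ->
  sb (rcons q b.+1) = rcons (sb (rcons q b)) false.
Proof.
case: b => // b q0 _; rewrite -!cats1 !sb_cat //= !cats0.
by rewrite -catA /= -[false :: nseq b _]/(nseq b.+1 false) -addn1 nseqD.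
Qed.

Lemma rot_sb b r : r <> [::] ->
  rot (index true (sb [:: b & r])).+2 (sb [:: 1%N, b & r]) = sb (r ++ [:: b; 1%N]).
Proof.
move=> r0.
have -> : sb [:: 1%N, b & r] = (true :: nseq b.-1 false ++ [:: true]) ++ sb r.
  by rewrite -[[:: 1%N, b & r]]/([:: 1%N; b] ++ r) sb_cat //= cats0 -catA.
have -> : index true (sb (b :: r)) = b.-1.
  rewrite -[b :: r]/([:: b] ++ r) sb_cat //= cats0 index_cat mem_nseq andbF /=.
  by rewrite size_nseq addn0.
have -> : b.-1.+2 = size (true :: nseq b.-1 false ++ [:: true]).
  by rewrite /= size_cat size_nseq addn1.
by rewrite rot_size_cat sb_cat.
Qed.

Local Close Scope ring_scope.
Unset Implicit Arguments.

(** * Cycling of the binary string *)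

Theorem theorem2p1 (R : realType) (f : bqf) (hf : Zreduced f) :
  [/\ (* (i) *)
      forall s : seq bool, sigma f = false :: s ->
        sigma (RZ R f) = rcons s false,
      (* (ii) *)
      forall k : nat, sigma f = true :: nseq k false ->
        sigma (RZ R f) = rcons (nseq k false) true
    & (* (iii): the second 1 of sigma f has 0-based position (index true s).+1 *)
      forall s : seq bool, sigma f = true :: s ->
        (2 <= count_mem true (sigma f))%N ->
        sigma (RZ R f) = rot (index true s).+2 (sigma f)].
Proof.
(* The empty string satisfies none of the three hypotheses. *)
have [->|/eqP sf] := eqVneq (sigma f) [::]; first by [].
have := size_beta_ge2 hf sf.
have [t [u [z [_ _ _ pq _]]]] := sigma_beads hf sf.
case eq : (beta f) pq => [|[|[|a]] [|b r]] //= pq _.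
(* First bead 1: cases (ii) and (iii). *)
- have eq' := beta_RZ_cons1 R hf sf eq.
  have sf1 : sigma f = true :: sb (b :: r) by rewrite /sigma eq.
  have sf2 : sigma (RZ R f) = sb (r ++ [:: b; 1]) by rewrite /sigma eq'.
  split; first by rewrite sf1.
  + move=> k; rewrite sf1 => -[ek].
    case: r {eq eq' pq sf1} sf2 ek => [-> /= | c r _ /= ek].
      by rewrite !cats0 => <-; rewrite cats1.
    have : true \in nseq k false by rewrite -ek mem_cat inE eqxx orbT.
    by rewrite mem_nseq andbF.
  + move=> s; rewrite sf1 => -[<-]; rewrite sf2 => cnt.
    have r0 : r <> [::].
      by move=> r0; move: cnt; rewrite r0 /= cats0 count_nseq.
    by rewrite -(rot_sb b r0) /sigma.
(* First bead at least 2: case (i). *)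
- rewrite lastI in eq; set q := belast b r in eq; set c := last b r in eq.
  have /allP /(_ _ (mem_last b r)) c0 : pos_seq (b :: r) by [].
  have sf1 : sigma f = false :: sb (a.+1 :: rcons q c) by rewrite /sigma eq.
  have eq' := beta_RZ_cons_ge2 R hf sf eq.
  split=> [s|k|s]; rewrite sf1 => // -[<-].
  by rewrite /sigma eq' -rcons_cons sb_incr_last.
Qed.
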